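(* Let $X$ be an infinite set and let $G$ be a group such that $\operatorname{Sym}_\omega(X)\subseteq G\subseteq \operatorname{Sym}(X)$. Then $\mathfrak{Z}^{\pm}_{4}(G)=\mathfrak{Z}^{\pm}(G)\neq \mathfrak{Z}(G)$.
   Context: $\operatorname{Sym}(X)$ is the symmetric group on $X$ (all permutations of $X$, composed from left to right), and $\operatorname{Sym}_\omega(X)$ is its subgroup of permutations with finite support; $G$ is a subgroup of $\operatorname{Sym}(X)$. Functions are written on the right of their arguments. Let $G$ be a group. A function $f:G\to G$ is a group polynomial of degree $n$ if $(x)f=a_0x^{\varepsilon_1}a_1\cdots x^{\varepsilon_n}a_n$ for some $a_0,\ldots,a_n\in G$ and $\varepsilon_1,\ldots,\varepsilon_n\in\{-1,1\}$; constant functions are group polynomials of degree $0$. The group Zariski topology $\mathfrak{Z}^{\pm}(G)$ is the topology on $G$ generated (as a subbase) by the sets $\{x\in G:(x)f\neq 1_G\}$, where $f$ is a group polynomial. For $n\in\mathbb{N}$, $\mathfrak{Z}^{\pm}_n(G)$ is the topology generated by the sets $\{x\in G:(x)f\neq 1_G\}$, where $f$ is a group polynomial of degree at most $n$. A function $f:G\to G$ is a semigroup polynomial of degree $n$ if $(x)f=a_0xa_1\cdots xa_n$ for some $a_0,\ldots,a_n\in G$; constant functions are semigroup polynomials of degree $0$. The semigroup Zariski topology $\mathfrak{Z}(G)$ is the topology on $G$ generated (as a subbase) by the sets $\{x\in G:(x)f\neq (x)g\}$, where $f,g$ are semigroup polynomials. *)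

(* Defs.v *)
From HB Require Import structures.
From mathcomp Require Import all_boot.
From mathcomp Require Import boolp classical_sets functions cardinality.
From mathcomp Require Import topology.

Set Implicit Arguments.
Unset Strict Implicit.
Unset Printing Implicit Defensive.

Local Open Scope classical_set_scope.
Local Open Scope group_scope.

Record Sym (X : Type) := MkSym {
  sym_fun :> X -> X;
  sym_asbool : `[< bijective sym_fun >] }.

HB.instance Definition _ (X : Type) := [isSub for @sym_fun X].
HB.instance Definition _ (X : Type) := gen_eqMixin (Sym X).
HB.instance Definition _ (X : Type) := gen_choiceMixin (Sym X).

Section SymGroup.
Variable X : Type.
Implicit Types s t u : Sym X.

Lemma sym_bij s : bijective s.
Proof. exact/asboolP/(valP s). Qed.

Lemma symP s t : s =1 t -> s = t.
Proof. by move=> st; apply/val_inj/funext. Qed.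

Lemma sym_inv_exists s : exists g : X -> X, cancel s g /\ cancel g s.
Proof. by have [g sK gK] := sym_bij s; exists g. Qed.

Definition sym_inv_fun s : X -> X := projT1 (cid (sym_inv_exists s)).

Lemma sym_funK s : cancel s (sym_inv_fun s).
Proof. exact: (projT2 (cid (sym_inv_exists s))).1. Qed.

Lemma sym_inv_funK s : cancel (sym_inv_fun s) s.
Proof. exact: (projT2 (cid (sym_inv_exists s))).2. Qed.

Lemma id_bijective : bijective (@id X).
Proof. by exists id. Qed.

Lemma sym_inv_bijective s : bijective (sym_inv_fun s).
Proof. exact: Bijective (@sym_inv_funK s) (@sym_funK s). Qed.

Lemma sym_mul_bijective s t : bijective (t \o s).
Proof. exact: bij_comp (sym_bij t) (sym_bij s). Qed.

Definition sym_one : Sym X := MkSym (asboolT id_bijective).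
Definition sym_inv s : Sym X := MkSym (asboolT (sym_inv_bijective s)).

(* Permutations are composed from left to right. *)
Definition sym_mul s t : Sym X := MkSym (asboolT (sym_mul_bijective s t)).

Lemma sym_mulA : associative sym_mul.
Proof. by move=> s t u; apply: symP. Qed.

Lemma sym_mul1 : left_id sym_one sym_mul.
Proof. by move=> s; apply: symP. Qed.

Lemma sym_mulr1 : right_id sym_one sym_mul.
Proof. by move=> s; apply: symP. Qed.

Lemma sym_mulV : left_inverse sym_one sym_inv sym_mul.
Proof. by move=> s; apply: symP => x; exact: sym_inv_funK. Qed.

Lemma sym_mulrV : right_inverse sym_one sym_inv sym_mul.
Proof. by move=> s; apply: symP => x; exact: sym_funK. Qed.

End SymGroup.

HB.instance Definition _ (X : Type) := isGroup.Build (Sym X)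
  (@sym_mulA X) (@sym_mul1 X) (@sym_mulr1 X) (@sym_mulV X) (@sym_mulrV X).

Definition Sym_fin (X : Type) : set (Sym X) :=
  [set s | finite_set [set x | s x <> x]].
Arguments Sym_fin : clear implicits.

Definition subbase_topology (T : Type) (B : set_system T) : Type := T.

HB.instance Definition _ (T : choiceType) (B : set_system T) :=
  Choice.on (subbase_topology B).
HB.instance Definition _ (T : choiceType) (B : set_system T) :=
  isSubBaseTopological.Build (subbase_topology B) B id.

(* A topology on T is represented by its set of open sets. *)
Definition generated_topology (T : choiceType) (B : set_system T) :
  set_system T := @open (subbase_topology B).

Section Zariski.
Variable G : groupType.

(* e i = true encodes the exponent -1, e i = false the exponent 1. *)
Definition group_polynomial (n : nat) (f : G -> G) : Prop :=
  exists (a : 'I_n.+1 -> G) (e : 'I_n -> bool),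
    forall x, f x = a ord0 *
      \prod_(i < n) ((if e i then x^-1 else x) * a (lift ord0 i)).

Definition semigroup_polynomial (n : nat) (f : G -> G) : Prop :=
  exists a : 'I_n.+1 -> G,
    forall x, f x = a ord0 * \prod_(i < n) (x * a (lift ord0 i)).

Definition group_zariski_topology : set_system G :=
  generated_topology
    [set [set x | f x <> 1] | f in [set f | exists n, group_polynomial n f]].

Definition group_zariski_topology_le (n : nat) : set_system G :=
  generated_topology
    [set [set x | f x <> 1] |
       f in [set f | exists2 m, (m <= n)%N & group_polynomial m f]].

Definition semigroup_zariski_topology : set_system G :=
  generated_topology
    [set U | exists f g : G -> G,
       [/\ exists m, semigroup_polynomial m f,
           exists n, semigroup_polynomial n g &
           U = [set x | f x <> g x]]].

End Zariski.

Arguments group_zariski_topology : clear implicits.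
Arguments group_zariski_topology_le : clear implicits.
Arguments semigroup_zariski_topology : clear implicits.

(* Main.v *)
Require Import Defs.
From HB Require Import structures.
From mathcomp Require Import all_boot.
From mathcomp Require Import boolp classical_sets functions cardinality.
From mathcomp Require Import topology.

(** Both halves of the theorem compare a Zariski topology with the topology of
pointwise convergence, whose subbasic open sets are the sets of all [g] with
[g x = y].

For the equality, pointwise open sets are already open for polynomials of
degree 4.  If [a] is the transposition of [y] and [w], and [b] that of [x] and
[z], then [g^-1 * b * g] is the transposition of [g x] and [g z], and the degree
4 polynomial [(a * (g^-1 * b * g))^2] is nontrivial when the pairs [{y, w}] and
[{g x, g z}] share exactly one point, and trivial when they are disjoint.  Let
[z] range over two points and [w] over three: if [g x <> y], then some [z] has
[g z <> y], and the two points [g x], [g z] would have to meet all three pairs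
[{y, w}] at [w], which is impossible.  So finitely many of these conditions
force [g x = y] ([point_open]).  Conversely the value at a point of any group
polynomial depends on finitely many values of [g] and [g^-1], so the polynomial
is locally constant pointwise ([group_polynomial_nbhs]) and its Zariski open
set is pointwise open.

For the inequality, the semigroup Zariski topology is hyperconnected: any two
nonempty open sets meet ([semigroup_zariski_meet]), whereas the pointwise open
sets [g x = x] and [g x = y] are nonempty and disjoint.  A nonempty subbasic set
is given by two distinct positive words in [g].  Cancelling a common prefix, one
may assume that their first letters differ, or that exactly one of the words
contains [g].  A finitary permutation [g] that sends finitely many points along
pairwise generic fresh trajectories then separates all pairs of a finite list at
once ([generic_separation]): after the first occurrence of [g] the image of a
point lies on a fresh trajectory, moves only forward along it since [g^-1] never
occurs, so two words that start on different trajectories end on different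
ones. *)

Set Implicit Arguments.
Unset Strict Implicit.
Unset Printing Implicit Defensive.

Local Open Scope classical_set_scope.
Local Open Scope group_scope.

(** * Topologies generated by a subbase *)

Section Subbase.
Variables (T : choiceType) (B : set_system T).

Lemma generated_topologyP (U : set T) (g : T) :
  generated_topology B U -> U g -> exists l : seq (set T),
   [/\ forall V, V \in l -> B V, forall V, V \in l -> V g &
       forall h, (forall V, V \in l -> V h) -> U h].
Proof.
move=> [F sF <-] [W FW Wg].
have [D sD WE] := sF _ FW.
exists (finmap.enum_fset D); split.
- by move=> V /sD/set_mem.
- by move=> V VD; move: Wg; rewrite -WE; apply.
- move=> h Vh; exists W => //; change (W h).
  by rewrite -WE => V /= /Vh.
Qed.

Lemma generated_topology_subbase (U : set T) : B U -> generated_topology B U.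
Proof.
move=> BU; exists [set U]; last by rewrite bigcup_set1.
by move=> _ ->; apply: (finI_from1 id).
Qed.

Lemma generated_topology_min (C : set_system T) :
  B `<=` generated_topology C ->
  generated_topology B `<=` generated_topology C.
Proof.
move=> BC U BU; rewrite /generated_topology openE => g Ug.
have [l [lB lg lU]] := generated_topologyP BU Ug.
have : nbhs (g : subbase_topology C) [set h | forall V, V \in l -> V h].
  elim: l lB lg {lU} => [|V l IH] lB lg.
    by apply: filterS filterT => h _.
  have Vg : nbhs (g : subbase_topology C) V.
    apply: open_nbhs_nbhs; split.
      by apply: BC; apply: lB; rewrite mem_head.
    by apply: lg; rewrite mem_head.
  apply: filterS (filterI Vg (IH _ _)).
  - by move=> h [Vh lh] W; rewrite inE => /orP[/eqP->|/lh].
  - by move=> W Wl; apply: lB; rewrite inE Wl orbT.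
  - by move=> W Wl; apply: lg; rewrite inE Wl orbT.
exact: filterS.
Qed.
End Subbase.

(** * Permutations *)

Lemma symME (X : Type) (s t : Sym X) p : (s * t) p = t (s p).
Proof. by []. Qed.

Lemma symK (X : Type) (s : Sym X) : cancel s (s^-1)%g.
Proof. exact: sym_funK. Qed.

Lemma symVK (X : Type) (s : Sym X) : cancel (s^-1)%g s.
Proof. exact: sym_inv_funK. Qed.

Lemma sym_inj (X : Type) (s : Sym X) : injective s.
Proof. exact: can_inj (symK s). Qed.

Section Transposition.
Variable X : eqType.
Implicit Types x y z : X.

Definition transpose_fun x y z :=
  if z == x then y else if z == y then x else z.

Lemma transpose_funK x y : involutive (transpose_fun x y).
Proof.
rewrite /transpose_fun => z.
case: (eqVneq z x) => [->|zx]; first by rewrite eqxx; case: eqP.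
case: (eqVneq z y) => [->|zy]; first by rewrite eqxx.
by rewrite (negPf zx) (negPf zy).
Qed.

Definition transposition x y : Sym X :=
  MkSym (asboolT (inv_bij (transpose_funK x y))).

Lemma transpositionE x y z :
  transposition x y z = if z == x then y else if z == y then x else z.
Proof. by []. Qed.

Lemma transpositionL x y : transposition x y x = y.
Proof. by rewrite transpositionE eqxx. Qed.

Lemma transpositionR x y : transposition x y y = x.
Proof. by rewrite transpositionE eqxx; case: eqP. Qed.

Lemma transposition_id x y z : z != x -> z != y -> transposition x y z = z.
Proof. by move=> /negPf zx /negPf zy; rewrite transpositionE zx zy. Qed.

Lemma transpositionJ (g : Sym X) x y :
  g^-1 * transposition x y * g = transposition (g x) (g y).
Proof.
apply: symP => z; rewrite !symME !transpositionE.
rewrite -[in RHS](symVK g z) !(inj_eq (@sym_inj _ g)).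
by case: eqP => // _; case: eqP.
Qed.

Lemma sym_fin_sub (g : Sym X) (s : seq X) :
  (forall z, z \notin s -> g z = z) -> Sym_fin X g.
Proof.
move=> gs; apply: sub_finite_set (finite_seq s) => z /= gz.
by apply: contrapT => /negP/gs.
Qed.

Lemma transposition_fin x y : Sym_fin X (transposition x y).
Proof.
apply: (@sym_fin_sub _ [:: x; y]) => z; rewrite !inE negb_or => /andP[zx zy].
exact: transposition_id.
Qed.

(** Controlling the support, and not only its finiteness, is what later makes
points off the prescribed trajectories fixed.  Each new prescription [x |-> y]
is met by composing with the transposition of the current image of [x] and
[y]. *)
Lemma extend_partial_injection (l : seq (X * X)) :
  uniq (unzip1 l) -> uniq (unzip2 l) -> exists g : Sym X,
  (forall c, c \in l -> g c.1 = c.2) /\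
  (forall z, z \notin unzip1 l -> z \notin unzip2 l -> g z = z).
Proof.
elim: l => [|[x y] l IH] /=; first by exists 1.
move=> /andP[xl /IH{}IH] /andP[yl /IH[g [gl gid]]].
exists (g * transposition (g x) y); split=> [c|z].
  rewrite inE symME => /predU1P[->/=|cl]; first exact: transpositionL.
  rewrite (gl _ cl) transposition_id //.
    rewrite -(gl _ cl) (inj_eq (@sym_inj _ g)).
    by apply: contraNneq xl => <-; apply: map_f.
  by apply: contraNneq yl => <-; apply: map_f.
rewrite !inE !negb_or symME => /andP[zx z1] /andP[zy z2].
have gz := gid _ z1 z2.
by rewrite gz transposition_id // -gz (inj_eq (@sym_inj _ g)).
Qed.

End Transposition.

Section TranspositionCommutator.
Variable X : eqType.
Implicit Types a b c d x y z : X.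

Lemma transpositionV a b : (transposition a b)^-1 = transposition a b.
Proof.
by apply: symP => z; apply: (@sym_inj _ (transposition a b)); rewrite symVK
  [RHS]transpose_funK.
Qed.

(** [transposition a b] conjugates [transposition c d] to itself. *)
Lemma disjoint_transpositions_commute a b c d :
  c != a -> c != b -> d != a -> d != b ->
  transposition a b * transposition c d * transposition a b * transposition c d
    = 1.
Proof.
move=> ca cb da db; rewrite -{1}(transpositionV a b) transpositionJ.
by rewrite !transposition_id // -{1}(transpositionV c d) mulVg.
Qed.

(** The product of the four transpositions moves [a] to [c]. *)
Lemma meeting_transpositions_not_commute a b c :
  b != a -> c != a -> c != b ->
  transposition a b * transposition a c * transposition a b * transposition a c
    <> 1.
Proof.
move=> ba ca cb /(congr1 (fun h : Sym X => h a)); rewrite !symME.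
rewrite transpositionL (@transposition_id _ _ _ b) // 1?eq_sym //.
by rewrite transpositionR transpositionL => /eqP; rewrite (negPf ca).
Qed.

End TranspositionCommutator.

(** * Generic permutations *)

Section GenericPoints.
Variable X : eqType.
Hypothesis infX : infinite_set [set: X].

Lemma fresh_point (s : seq X) : exists x, x \notin s.
Proof.
apply: contrapT => ns; apply: infX.
apply: sub_finite_set (finite_seq s) => x _ /=.
by apply: contrapT => /negP xs; apply: ns; exists x.
Qed.

(** Since [V] is closed under inverses, choosing the points [Y k] one after the
other only requires each new point to avoid a finite set. *)
Lemma generic_points (K : eqType) (ks : seq K) (P : seq X) (V : seq (Sym X)) :
  (forall v, v \in V -> v^-1 \in V) -> exists Y : K -> X,
  forall k v, k \in ks -> v \in V ->
    v (Y k) \notin P /\ (forall k', k' \in ks -> v (Y k) = Y k' -> k = k').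
Proof.
move=> VV; elim: ks => [|k0 ks [Y IH]].
  by have [x _] := fresh_point [::]; exists (fun=> x).
have [x xbad] := fresh_point [seq v c | v : Sym X <- V, c <- P ++ map Y ks].
have bad v c : v \in V -> c \in P ++ map Y ks -> v c <> x.
  move=> vV cP vc; move/negP: xbad; apply; rewrite -vc.
  exact: (allpairs_f (fun (v : Sym X) c => v c)).
have bad' v c : v \in V -> c \in P ++ map Y ks -> v x <> c.
  by move=> vV cP vx; apply: (bad _ _ (VV _ vV) cP); rewrite -vx symK.
exists (fun k => if k == k0 then x else Y k) => k v; rewrite inE => kk vV.
split=> [|k'].
  case: eqVneq kk => [-> _|_ /= kk]; last by case: (IH _ _ kk vV).
  by apply/negP => vP; apply: (bad' v (v x)) => //; rewrite mem_cat vP.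
rewrite inE.
case: (eqVneq k k0) kk => [-> _|_ /= kk];
  case: (eqVneq k' k0) => [-> _ //|_ /= kk'].
- by move=> vx; case: (bad' v (Y k') vV) => //; rewrite mem_cat map_f ?orbT.
- by move=> vx; case: (bad v (Y k) vV) => //; rewrite mem_cat map_f ?orbT.
- by have [_ /(_ _ kk')] := IH _ _ kk vV.
Qed.

(** Each [e] in [P] starts a trajectory [pt e 0 = e], [pt e 1], ..., [pt e L]
along which [g] moves it.  Applying elements of [W] never leads from a point
beyond the start of a trajectory to another point of a trajectory: this lets
one follow a word in [g] whose letters are otherwise arbitrary. *)
Lemma generic_permutation (W : seq (Sym X)) (P : seq X) (L : nat) :
  1 \in W ->
  exists (g : Sym X) (pt : X -> nat -> X),
  [/\ Sym_fin X g,
      forall e, pt e 0%N = e,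
      forall e k, e \in P -> (k < L)%N -> g (pt e k) = pt e k.+1,
      forall e k w, e \in P -> (0 < k <= L)%N -> w \in W ->
        w (pt e k) <> pt e k -> g (w (pt e k)) = w (pt e k) &
      forall e e' k k' u w, e \in P -> e' \in P -> (0 < k <= L)%N ->
        (k' <= L)%N -> u \in W -> w \in W -> u (pt e k) = w (pt e' k') ->
        e = e' /\ k = k'].
Proof.
move=> W1; pose Q := undup P.
(* [u y = w y'] says that [u * w^-1] sends [y] to [y']. *)
pose V := [seq u * w^-1 | u <- W, w <- W].
have VV v : v \in V -> v^-1 \in V.
  move=> /allpairsP[[u w] /= [uW wW ->]]; rewrite invgM invgK.
  exact: (allpairs_f (fun u w : Sym X => u * w^-1)).
have [Y YP] := generic_points [seq (e, k) | e <- Q, k <- iota 0 L] P VV.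
pose pt e k := if k is k'.+1 then Y (e, k') else e.
have gen e e' k k' u w : e \in P -> e' \in P -> (0 < k <= L)%N ->
    (k' <= L)%N -> u \in W -> w \in W -> u (pt e k) = w (pt e' k') ->
    e = e' /\ k = k'.
  move=> eP e'P; case: k => //= k kL k'L uW wW uw.
  have vV : u * w^-1 \in V by apply: (allpairs_f (fun u w : Sym X => u * w^-1)).
  have ekQ : (e, k) \in [seq (e, k) | e <- Q, k <- iota 0 L].
    by apply: (allpairs_f pair); rewrite ?mem_undup ?mem_iota.
  have [nP inj] := YP _ _ ekQ vV.
  have vE : (u * w^-1) (Y (e, k)) = pt e' k' by rewrite symME uw symK.
  case: k' k'L vE {uw} => [_|k' k'L] vE; first by rewrite vE e'P in nP.
  have e'Q : (e', k') \in [seq (e, k) | e <- Q, k <- iota 0 L].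
    by apply: (allpairs_f pair); rewrite ?mem_undup ?mem_iota.
  by case: (inj _ e'Q vE) => -> ->.
have ptinj e e' k k' : e \in P -> e' \in P -> (k <= L)%N -> (k' <= L)%N ->
    pt e k = pt e' k' -> e = e' /\ k = k'.
  move=> eP e'P; case: k => [|k] kL k'L E; last exact: (gen _ _ _ _ 1 1).
  case: k' k'L E => [|k'] k'L E //.
  by have [|-> ->] := gen e' e k'.+1 0%N 1 1 e'P eP k'L kL W1 W1.
pose l := [seq (pt e k, pt e k.+1) | e <- Q, k <- iota 0 L].
have l1 : unzip1 l = [seq pt e k | e <- Q, k <- iota 0 L].
  by rewrite /unzip1 /l map_allpairs.
have l2 : unzip2 l = [seq pt e k.+1 | e <- Q, k <- iota 0 L].
  by rewrite /unzip2 /l map_allpairs.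
have [||g [gl gid]] := @extend_partial_injection _ l.
- rewrite l1; apply: allpairs_uniq; rewrite ?undup_uniq ?iota_uniq //.
  move=> _ _ /allpairsP[[e k] /= [eQ kL ->]] /allpairsP[[e' k'] /= [e'Q k'L ->]].
  move: eQ e'Q kL k'L; rewrite !mem_undup !mem_iota /= => eQ e'Q kL k'L E.
  by have [||-> ->] := ptinj e e' k k' eQ e'Q _ _ E => //; apply: ltnW.
- rewrite l2; apply: allpairs_uniq; rewrite ?undup_uniq ?iota_uniq //.
  move=> _ _ /allpairsP[[e k] /= [eQ kL ->]] /allpairsP[[e' k'] /= [e'Q k'L ->]].
  move: eQ e'Q kL k'L; rewrite !mem_undup !mem_iota /= => eQ e'Q kL k'L E.
  by have [||-> [->]] := ptinj e e' k.+1 k'.+1 eQ e'Q _ _ E.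
exists g, pt; split => //.
- apply: (@sym_fin_sub _ _ (unzip1 l ++ unzip2 l)) => z.
  by rewrite mem_cat negb_or => /andP[]; apply: gid.
- move=> e k eP kL; apply: (gl (pt e k, pt e k.+1)).
  by apply: (allpairs_f (fun e k => (pt e k, pt e k.+1)));
    rewrite ?mem_undup ?mem_iota.
- move=> e k w eP kL wW ne; apply: gid; apply/negP; rewrite ?l1 ?l2.
    move=> /allpairsP[[e' k'] /=]; rewrite mem_undup mem_iota => -[e'P k'L E].
    by have [|ee' kk'] := gen e e' k k' w 1 eP e'P kL (ltnW k'L) wW W1; [|subst].
  move=> /allpairsP[[e' k'] /=]; rewrite mem_undup mem_iota => -[e'P k'L E].
  by have [|ee' kk'] := gen e e' k k'.+1 w 1 eP e'P kL k'L wW W1; [|subst].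
Qed.

End GenericPoints.

(** * Positive words *)

Section PositiveWords.
Variable G : groupType.
Implicit Types (g a b w : G) (s t : seq G).

(** The value at [g] of the semigroup polynomial with coefficients [a :: s]; the
first coefficient is apart so that a polynomial has at least one. *)
Fixpoint word_eval g a s : G :=
  if s is b :: s' then a * g * word_eval g b s' else a.

Lemma semigroup_polynomial_word n (f : G -> G) : semigroup_polynomial n f ->
  exists a s, forall g, f g = word_eval g a s.
Proof.
elim: n f => [|n IH] f [a fE].
  by exists (a ord0), [::] => g; rewrite fE big_ord0 mulg1.
have [|b [s sE]] := IH (fun g => a (lift ord0 ord0) *
    \prod_(i < n) (g * a (lift ord0 (lift ord0 i)))).
  by exists (fun i => a (lift ord0 i)).
by exists (a ord0), (b :: s) => g; rewrite fE /= -sE big_ord_recl !mulgA.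
Qed.

(** What is left of two distinct words after cancelling their common prefix. *)
Definition reduced_pair a s b t := a = b -> nilp s != nilp t.

(** Equal first letters are cancelled, together with the following variable, as
long as both words contain the variable.  Two equal constants cannot be left,
since the words differ at [g]. *)
Lemma reduce_pair g a s b t : word_eval g a s <> word_eval g b t ->
  exists a' s' b' t', reduced_pair a' s' b' t' /\
    forall h, word_eval h a s = word_eval h b t ->
      word_eval h a' s' = word_eval h b' t'.
Proof.
elim: s a b t => [|a1 s IH] a b [|b1 t] st.
- by exists a, [::], b, [::]; split=> // /st.
- by exists a, [::], b, (b1 :: t); split=> // _.
- by exists a, (a1 :: s), b, [::]; split=> // _.
have [ab|ab] := eqVneq a b; last first.
  by exists a, (a1 :: s), b, (b1 :: t); split=> // /eqP; rewrite (negPf ab).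
move: st; rewrite ab /= => st.
have [|a' [s' [b' [t' [red st']]]]] := IH a1 b1 t.
  by move=> E; apply: st; rewrite E.
by exists a', s', b', t'; split=> // h /mulgI/st'.
Qed.

Fixpoint words_upto (A : seq G) n : seq G :=
  if n is m.+1 then words_upto A m ++ [seq w * a | w <- words_upto A m, a <- A]
  else [:: 1].

Lemma words_uptoS A n w : w \in words_upto A n -> w \in words_upto A n.+1.
Proof. by move=> wA; rewrite /= mem_cat wA. Qed.

Lemma words_uptoM A n w a :
  w \in words_upto A n -> a \in A -> w * a \in words_upto A n.+1.
Proof.
by move=> wA aA; rewrite /= mem_cat orbC (allpairs_f (fun w a => w * a)).
Qed.

Lemma words_upto_mono A m n w :
  (m <= n)%N -> w \in words_upto A m -> w \in words_upto A n.
Proof.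
move=> mn wA; rewrite -(subnK mn); elim: (n - m)%N => // k IH.
by rewrite addSn; apply: words_uptoS.
Qed.

Lemma words_upto1 A n : 1 \in words_upto A n.
Proof. by apply: (@words_upto_mono _ 0) => //; rewrite mem_head. Qed.

End PositiveWords.

Section Separation.
Variable X : eqType.
Hypothesis infX : infinite_set [set: X].

(** A pair of words is separated at a point [p] whose images [e], [e'] under the
first letters differ whenever these letters do.  A word that contains [g] sends
[p] to some [w (pt e k)] with [k > 0], a constant word sends it to
[e = pt e 0], so genericity forces equal ends to have [e = e'] and to come from
words of the same kind, against reducedness. *)
Lemma generic_separation
    (D : seq ((Sym X * seq (Sym X)) * (Sym X * seq (Sym X)))) :
  (forall d, d \in D -> reduced_pair d.1.1 d.1.2 d.2.1 d.2.2) ->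
  exists g, Sym_fin X g /\
    forall d, d \in D -> word_eval g d.1.1 d.1.2 <> word_eval g d.2.1 d.2.2.
Proof.
move=> Dred.
(* A run multiplies at most as many letters, and takes at most as many steps,
   as there are letters in total. *)
pose E := [seq d.1 | d <- D] ++ [seq d.2 | d <- D].
pose A := flatten [seq e.1 :: e.2 | e <- E].
pose L := (size A).+1.
pose W := words_upto A L.
have ED d : d \in D -> d.1 \in E /\ d.2 \in E.
  by move=> dD; rewrite !mem_cat !map_f ?orbT.
have EA e : e \in E -> {subset e.1 :: e.2 <= A}.
  by move=> eE a ae; apply/flattenP; exists (e.1 :: e.2) => //; apply: map_f.
have EL e : e \in E -> (size e.2 < L)%N.
  rewrite /L /A; elim: (E) => //= e' E' IH; rewrite inE size_cat.
  move=> /predU1P[->|/IH]; first by rewrite !ltnS leqW // leq_addr.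
  by rewrite !ltnS => /leq_trans; apply; rewrite leqW // leq_addl.
have /choice[p pP] (d : (Sym X * seq (Sym X)) * (Sym X * seq (Sym X))) :
    exists p, d.1.1 p = d.2.1 p -> d.1.1 = d.2.1.
  apply: contrapT => np; have [x _] := fresh_point infX [::].
  case: (np); exists x => _; apply: symP => q; apply: contrapT => nq.
  by apply: np; exists q.
pose P := [seq sym_fun d.1.1 (p d) | d <- D] ++
  [seq sym_fun d.2.1 (p d) | d <- D].
have [g [pt [gfin pt0 ptS gid gen]]] :=
  generic_permutation infX P L (words_upto1 A L).
(* The state of a run is a translate [w (pt e k)]: the next letter extends [w],
   and the next [g] either fixes the state or, when the state is [pt e k]
   itself, moves it to [pt e k.+1]. *)
have track s a w j e k : e \in P -> {subset a :: s <= A} ->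
    w \in words_upto A j -> (j + (size s).+1 <= L)%N -> (0 < k)%N ->
    (k + size s <= L)%N -> exists w' k',
    [/\ w' \in W, (0 < k' <= L)%N & word_eval g a s (w (pt e k)) = w' (pt e k')].
  move=> eP; elim: s a w j k => [|b s IH] a w j k asA wA jL k0 kL.
    exists (w * a), k; rewrite k0 -(addn0 k) kL; split=> //.
    apply: (words_upto_mono jL); rewrite addn1.
    by apply: words_uptoM => //; apply: asA; rewrite mem_head.
  have aA : a \in A by apply: asA; rewrite mem_head.
  have bsA : {subset b :: s <= A} by move=> c cs; apply: asA; rewrite inE cs orbT.
  have waA := words_uptoM wA aA.
  have waW : w * a \in W.
    by apply: (words_upto_mono _ waA); rewrite -addn1 (leq_trans _ jL) ?leq_add2l.
  have kL' : (k < L)%N by rewrite (leq_trans _ kL) // /= addnS ltnS leq_addr.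
  have [wa|wa] := EM ((w * a) (pt e k) = pt e k).
    have [||||w' [k' [w'W k'L ev]]] := IH b 1 0%N k.+1 bsA; rewrite ?words_upto1 //.
    - by rewrite add0n (leq_trans _ jL) //= addnS leqW // leq_addl.
    - by rewrite addSnnS.
    exists w', k'; split=> //.
    by rewrite -ev -[LHS]/(word_eval g b s (g ((w * a) (pt e k)))) wa ptS.
  have [|||w' [k' [w'W k'L ev]]] := IH b _ j.+1 k bsA waA => //.
  - by rewrite addSnnS.
  - by rewrite (leq_trans _ kL) // leq_add2l /=.
  exists w', k'; split=> //.
  rewrite -ev -[LHS]/(word_eval g b s (g ((w * a) (pt e k)))) gid //.
  by rewrite k0 ltnW.
have trackE (e : Sym X * seq (Sym X)) q : e \in E -> e.1 q \in P ->
    exists w' k', [/\ w' \in W, (k' <= L)%N, (k' == 0)%N = nilp e.2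
      & word_eval g e.1 e.2 q = w' (pt (e.1 q) k')].
  case: e => a [|b s] eE qP.
    by exists 1, 0%N; rewrite words_upto1 pt0.
  have := EL _ eE; rewrite /= => sL.
  have [|||||w' [k' [w'W /andP[k'0 k'L] ev]]] :=
    @track s b 1 0%N (a q) 1%N qP; rewrite ?words_upto1 //.
  - by move=> c cs; apply: (EA _ eE); rewrite inE cs orbT.
  - by rewrite add0n ltnW.
  - by rewrite add1n ltnW.
  exists w', k'; split=> //; first by rewrite gtn_eqF.
  rewrite -ev -[LHS]/(word_eval g b s (g (a q))) -{1}(pt0 (a q)) ptS //.
exists g; split=> // d dD /(congr1 (fun h : Sym X => h (p d))).
have [d1 d2] := ED _ dD; have red := Dred _ dD.
have d1P : d.1.1 (p d) \in P.
  by rewrite mem_cat (map_f (fun d => sym_fun d.1.1 (p d))).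
have d2P : d.2.1 (p d) \in P.
  by rewrite mem_cat (map_f (fun d => sym_fun d.2.1 (p d))) ?orbT.
have [u [k [uW kL k0 uE]]] := trackE _ _ d1 d1P.
have [w [l [wW lL l0 wE]]] := trackE _ _ d2 d2P.
move=> guw; have uw := guw; rewrite uE wE in uw; have [kz|kn] := posnP k.
  have [lz|ln] := posnP l.
    have n1 : d.1.2 = [::] by apply/nilP; rewrite -k0 kz.
    have n2 : d.2.2 = [::] by apply/nilP; rewrite -l0 lz.
    by move: guw; rewrite n1 n2 => /pP/red; rewrite n1 n2.
  have [|E1 E2] := gen _ _ _ _ _ _ d2P d1P _ kL wW uW (esym uw).
    by rewrite ln.
  by move: ln; rewrite E2 kz.
have [|E1 E2] := gen _ _ _ _ _ _ d1P d2P _ lL uW wW uw; first by rewrite kn.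
by have := red (pP _ E1); rewrite -k0 -l0 E2 eqxx.
Qed.
End Separation.

(** * The Zariski topologies of a group of permutations *)

Section ZariskiTopologies.
Variables (X : eqType) (S : pred (Sym X)) (G : subGroupType S).
Hypothesis infX : infinite_set [set: X].
Hypothesis finS : Sym_fin X `<=` [set s | s \in S].
Local Notation valG := (val : G -> Sym X).

Lemma finitary_lift (s : Sym X) : Sym_fin X s -> exists g : G, valG g = s.
Proof. by move=> /finS sS; exists (Sub s sS); rewrite SubK. Qed.

Lemma valGM (g h : G) : valG (g * h) = valG g * valG h.
Proof. exact: gmulfM. Qed.

Lemma valG1 : valG 1 = 1.
Proof. exact: gmulf1. Qed.

Lemma valGV (g : G) : valG g^-1 = (valG g)^-1.
Proof. exact: gmulfV. Qed.

Lemma val_word_eval (g a : G) s :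
  valG (word_eval g a s) = word_eval (valG g) (valG a) (map valG s).
Proof. by elim: s a => //= b s IH a; rewrite !valGM IH. Qed.

(** The semigroup Zariski topology is hyperconnected.  A nonempty subbasic set
contains all [k] separating some reduced pair of words, and one generic finitary
permutation separates the finitely many pairs involved. *)
Lemma semigroup_zariski_meet (U V : set G) (g h : G) :
  semigroup_zariski_topology G U -> semigroup_zariski_topology G V ->
  U g -> V h -> exists k, U k /\ V k.
Proof.
move=> oU oV Ug Vh.
have [l [lB lg lU]] := generated_topologyP oU Ug.
have [m [mB mh mV]] := generated_topologyP oV Vh.
have lift_pair (B : set G) :
    exists d : (Sym X * seq (Sym X)) * (Sym X * seq (Sym X)), B \in l ++ m ->
      reduced_pair d.1.1 d.1.2 d.2.1 d.2.2 /\
      forall k : G, word_eval (valG k) d.1.1 d.1.2 <>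
        word_eval (valG k) d.2.1 d.2.2 -> B k.
  (* The default pair is only used for sets outside the two lists. *)
  have [Bl|nB] := boolP (B \in l ++ m); last by exists ((1, [::]), (1, [::])).
  have [[f [f' [[? /semigroup_polynomial_word[a [s sE]]]
    [? /semigroup_polynomial_word[b [t tE]]] BE]]] [k Bk]] :
    (exists f g : G -> G, [/\ exists m, semigroup_polynomial m f,
      exists n, semigroup_polynomial n g & B = [set x | f x <> g x]]) /\
    exists k, B k.
    move: Bl; rewrite mem_cat => /orP[Bl|Bm].
    - by split; [exact: lB | exists g; exact: lg].
    - by split; [exact: mB | exists h; exact: mh].
  rewrite BE /= sE tE in Bk.
  have [|a' [s' [b' [t' [red st']]]]] :=
    @reduce_pair _ (valG k) (valG a) (map valG s) (valG b) (map valG t).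
    by rewrite -!val_word_eval => /val_inj.
  exists ((a', s'), (b', t')) => _; split=> // i ne; rewrite BE /= sE tE => E.
  by apply: ne; apply: st'; rewrite -!val_word_eval E.
have [d dP] := choice lift_pair.
have [|k [kfin kd]] := @generic_separation _ infX [seq d B | B <- l ++ m].
  by move=> _ /mapP[B Bl ->]; case: (dP B Bl).
have [k' kE] := finitary_lift kfin.
have lm B : B \in l ++ m -> B k'.
  by move=> Bl; apply: (dP B Bl).2; rewrite kE; apply: kd; exact: map_f.
by exists k'; split; [apply: lU | apply: mV] => B Bl; apply: lm;
  rewrite mem_cat Bl ?orbT.
Qed.

Let Z4 := [set [set x | f x <> 1] |
       f in [set f : G -> G | exists2 m, (m <= 4)%N & group_polynomial m f]].
Local Notation T4 := (subbase_topology Z4).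

(** The commutator of [a] and the conjugate of [b] by [g], when [a] and [b] are
involutions. *)
Definition commutator_word (a b g : G) : G :=
  a * (g^-1 * b * g) * a * (g^-1 * b * g).

Lemma commutator_word_polynomial a b : group_polynomial 4 (commutator_word a b).
Proof.
exists (fun i : 'I_5 => nth 1 [:: a; b; a; b; 1] i), (fun i : 'I_4 => ~~ odd i).
by move=> g; rewrite !big_ord_recl big_ord0 /= !mulg1 /commutator_word !mulgA.
Qed.

(** The condition that the transpositions of [y], [w] and of [g x], [g z] do not
commute is open of degree 4, holds at [g0], and forces the pairs to meet. *)
Lemma nbhs_meet (g0 : G) x y z w : valG g0 x = y -> z != x -> w != y ->
  valG g0 z != w ->
  \forall g \near (g0 : T4),
    [|| valG g x == y, valG g z == y, valG g x == w | valG g z == w].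
Proof.
move=> g0x zx wy g0z.
have [a aE] := finitary_lift (transposition_fin y w).
have [b bE] := finitary_lift (transposition_fin x z).
have valE g : valG (commutator_word a b g) =
    transposition y w * transposition (valG g x) (valG g z) *
    transposition y w * transposition (valG g x) (valG g z).
  by rewrite /commutator_word !valGM !valGV aE bE -transpositionJ !mulgA.
have : nbhs (g0 : T4) [set g | commutator_word a b g <> 1].
  apply: open_nbhs_nbhs; split.
    apply: generated_topology_subbase; exists (commutator_word a b) => //.
    by exists 4%N => //; exact: commutator_word_polynomial.
  move=> /= /(congr1 valG); rewrite valE valG1 g0x.
  apply: meeting_transpositions_not_commute => //.
  by rewrite -g0x (inj_eq (@sym_inj _ _)).
apply: filterS => g /=; apply: contra_notT.
rewrite !negb_or => /and4P[xy zy xw zw].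
by apply: val_inj; rewrite valE valG1 disjoint_transpositions_commute.
Qed.

(** [z1] and [z2] are chosen away from the preimages of [w1], [w2], [w3] under
[g0], so that [nbhs_meet] applies to the six pairs.  If [g x <> y], one of
[z1], [z2] is not sent to [y] either, and then three distinct points would lie
in [{g x, g z}]. *)
Lemma nbhs_point (g0 : G) x : \forall g \near (g0 : T4), valG g x = valG g0 x.
Proof.
set y := valG g0 x.
have [w1 w1P] := fresh_point infX [:: y].
have [w2 w2P] := fresh_point infX [:: y; w1].
have [w3 w3P] := fresh_point infX [:: y; w1; w2].
pose bad := [seq (valG g0)^-1%g w | w : X <- [:: w1; w2; w3]].
have [z1 /norP[z1x z1b]] := fresh_point infX (x :: bad).
have [z2 /norP[z2x /norP[z21 z2b]]] := fresh_point infX [:: x, z1 & bad].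
move: w1P w2P w3P; rewrite !inE !negb_or.
move=> w1y /andP[w2y w21] /and3P[w3y w31 w32].
have badP z w : w \in [:: w1; w2; w3] -> z \notin bad -> valG g0 z != w.
  move=> wl; apply: contraNneq => zw.
  by apply/mapP; exists w; rewrite // -zw symK.
have meet z w : w \in [:: w1; w2; w3] -> z != x -> w != y -> z \notin bad ->
    \forall g \near (g0 : T4),
      [|| valG g x == y, valG g z == y, valG g x == w | valG g z == w].
  by move=> wl zx wy zb; apply: nbhs_meet => //; exact: badP.
have pigeon (g : G) z : valG g x != y -> valG g z != y ->
    ~ (forall w, w \in [:: w1; w2; w3] ->
      [|| valG g x == y, valG g z == y, valG g x == w | valG g z == w]).
  move=> /negPf xy /negPf zy H.
  have := H w1; have := H w2; have := H w3.
  rewrite !inE !eqxx ?orbT xy zy /= => /(_ isT) e3 /(_ isT) e2 /(_ isT) e1.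
  case/orP: e1 => /eqP e1; case/orP: e2 => /eqP e2; case/orP: e3 => /eqP e3;
    by move: w21 w31 w32; rewrite -?e1 -?e2 -?e3 ?e1 ?e2 ?e3 eqxx.
have meets z : z != x -> z \notin bad ->
    \forall g \near (g0 : T4), forall w, w \in [:: w1; w2; w3] ->
      [|| valG g x == y, valG g z == y, valG g x == w | valG g z == w].
  move=> zx zb.
  have n1 := meet z w1 _ zx w1y zb; have n2 := meet z w2 _ zx w2y zb.
  have n3 := meet z w3 _ zx w3y zb.
  near=> g => w; rewrite !inE => /or3P[] /eqP ->; near: g.
  - by apply: n1; rewrite !inE eqxx.
  - by apply: n2; rewrite !inE eqxx orbT.
  - by apply: n3; rewrite !inE eqxx !orbT.
have m1 := meets z1 z1x z1b; have m2 := meets z2 z2x z2b.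
apply: filterS (filterI m1 m2) => g /= [{}m1 {}m2].
apply: contrapT => /eqP xy.
have [zy|zy] := eqVneq (valG g z1) y; last exact: pigeon m1.
apply: (pigeon g z2) => //; rewrite -zy (inj_eq (@sym_inj _ _)) //.
Unshelve. all: end_near.
Qed.

Lemma nbhs_inv_point (g0 : G) x :
  \forall g \near (g0 : T4), valG g^-1 x = valG g0^-1 x.
Proof.
apply: filterS (nbhs_point g0 (valG g0^-1 x)) => g.
rewrite !valGV symVK => gx.
by apply: (@sym_inj _ (valG g)); rewrite symVK gx.
Qed.

(** Evaluation at a point is locally constant for constants, for [g] and for
[g^-1], and this property is stable under products since [(f1 * f2) x] is
[f2 (f1 x)]. *)
Lemma group_polynomial_nbhs n (f : G -> G) (g0 : G) x : group_polynomial n f ->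
  \forall g \near (g0 : T4), valG (f g) x = valG (f g0) x.
Proof.
move=> [a [e fE]].
rewrite (_ : f = fun g => a ord0 * \prod_(i < n)
    ((if e i then g^-1 else g) * a (lift ord0 i))); last exact/funext.
have fM (f1 f2 : G -> G) : (forall x,
    \forall g \near (g0 : T4), valG (f1 g) x = valG (f1 g0) x) -> (forall x,
    \forall g \near (g0 : T4), valG (f2 g) x = valG (f2 g0) x) -> forall x,
    \forall g \near (g0 : T4), valG (f1 g * f2 g) x = valG (f1 g0 * f2 g0) x.
  move=> l1 l2 z; apply: filterS (filterI (l1 z) (l2 (valG (f1 g0) z))) => g.
  by move=> /= [E1 E2]; rewrite !valGM !symME E1 E2.
have fC b z : \forall g \near (g0 : T4), valG b z = valG b z.
  by apply: filterS filterT.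
have fP m (u : 'I_m -> bool) (b : 'I_m -> G) z : \forall g \near (g0 : T4),
    valG (\prod_(i < m) ((if u i then g^-1 else g) * b i)) z =
    valG (\prod_(i < m) ((if u i then g0^-1 else g0) * b i)) z.
  elim: m u b z => [|m IH] u b z.
    by apply: filterS filterT => g _; rewrite !big_ord0.
  have last_factor t : \forall g \near (g0 : T4),
      valG ((if u ord_max then g^-1 else g) * b ord_max) t =
      valG ((if u ord_max then g0^-1 else g0) * b ord_max) t.
    apply: (fM (fun g => if u ord_max then g^-1 else g)
      (fun=> b ord_max)) => // {}t.
    by case: (u ord_max); [exact: nbhs_inv_point | exact: nbhs_point].
  apply: filterS (fM _ _ (IH (fun i => u (widen_ord (leqnSn m) i))
    (fun i => b (widen_ord (leqnSn m) i))) last_factor z) => g.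
  by rewrite !big_ord_recr.
apply: (fM (fun=> a ord0)) => z; first exact: fC.
exact: (fP n e (fun i => a (lift ord0 i))).
Qed.

Lemma group_zariski_le4 :
  group_zariski_topology_le G 4 = group_zariski_topology G.
Proof.
apply/seteqP; split; apply: generated_topology_min => _ [f fP <-].
  apply: generated_topology_subbase; exists f => //.
  by case: fP => n _ fn; exists n.
case: fP => n fP; rewrite /generated_topology openE => g0 /= fg0.
have [x fx] : exists x, valG (f g0) x <> x.
  apply: contrapT => nx; apply: fg0; apply: val_inj; apply: symP => x.
  by rewrite valG1; apply: contrapT => fx; apply: nx; exists x.
apply: filterS (group_polynomial_nbhs g0 x fP) => g /= fg f1.
by apply: fx; rewrite -fg f1 valG1.
Qed.

Lemma point_open (x y : X) :
  group_zariski_topology_le G 4 [set g | valG g x = y].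
Proof.
rewrite /group_zariski_topology_le /generated_topology openE => g0 /= g0x.
by apply: filterS (nbhs_point g0 x) => g /= ->.
Qed.

Lemma group_zariski_neq_semigroup_zariski :
  group_zariski_topology G <> semigroup_zariski_topology G.
Proof.
rewrite -group_zariski_le4 => E.
have [x _] := fresh_point infX [::].
have [y yx] := fresh_point infX [:: x].
have [t tE] := finitary_lift (transposition_fin x y).
have := @semigroup_zariski_meet
  [set g | valG g x = x] [set g | valG g x = y] 1 t.
rewrite -E => /(_ (point_open _ _) (point_open _ _)) [].
- by rewrite /= valG1.
- by rewrite /= tE transpositionL.
by move=> g [/= -> xy]; move: yx; rewrite xy inE eqxx.
Qed.

End ZariskiTopologies.

Theorem theorem1p8 (X : Type) (infX : infinite_set [set: X])
    (S : pred (Sym X)) (G : subGroupType S)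
    (finS : Sym_fin X `<=` [set s | s \in S]) :
  group_zariski_topology_le G 4 = group_zariski_topology G /\
  group_zariski_topology G <> semigroup_zariski_topology G.
Proof.
(* Decidable equality on X, supplied by classical logic. *)
pose X' : eqType := HB.pack X (gen_eqMixin X).
have := (@group_zariski_le4 X' S G infX finS,
  @group_zariski_neq_semigroup_zariski X' S G infX finS).
by case.
Qed.
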